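(* Let $W_f$ be the weight spectrum of $RM(7,14)$, let $$W_0=\{0,128,192,224,240,248,252,254,256,272,288,296,304,308\},$$ and let $$M=\{322,326,330,334,354,8174,8178,8182,8186,8188,8190,8194,8196,8198,8202,8206,8210,16030,16050,16054,16058,16062\}.$$ Then $$\Big(W_0\cup\{312+2i \mid i\in\mathbb{Z},\ 0\le i\le 2^{13}-312\}\cup\{2^{14}-w \mid w\in W_0\}\Big)\setminus M\ \subseteq\ W_f .$$
   Context: For a positive integer $m$, $B_m$ is the set of Boolean functions $f:\mathbb{F}_2^m\to\mathbb{F}_2$. Each such function is uniquely a polynomial in $\mathbb{F}_2[x_1,\dots,x_m]$ with every variable of degree at most $1$ (its algebraic normal form), and its degree is the degree of this polynomial. $RM(r,m)$ is the set of $f\in B_m$ of degree at most $r$. The Hamming weight is $wt(f)=|\{x\in\mathbb{F}_2^m : f(x)=1\}|$. The weight spectrum of $RM(r,m)$ is the set $\{wt(f) : f\in RM(r,m)\}$. *)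

(* Defs.v *)
From mathcomp Require Export all_boot all_algebra.
From mathcomp Require Export mpoly.
From mathcomp Require Export boolp classical_sets.

Set Implicit Arguments.
Unset Strict Implicit.
Unset Printing Implicit Defensive.

Import GRing.Theory.

Local Open Scope ring_scope.
Local Open Scope classical_set_scope.

Definition boolean_function (m : nat) := 'rV['F_2]_m -> 'F_2.

Definition is_anf (m : nat) (p : {mpoly 'F_2[m]}) (f : boolean_function m) : Prop :=
  (forall u : 'X_{1..m}, u \in msupp p -> forall i : 'I_m, (u i <= 1)%N) /\
  (forall x : 'rV['F_2]_m, f x = p.@[fun i => x 0 i]).

(* [msize p] is 1 + the degree of [p], and 0 for [p = 0]; the zero function
   therefore belongs to every [RM r m]. *)
Definition RM (r m : nat) : set (boolean_function m) :=
  [set f | exists2 p : {mpoly 'F_2[m]}, is_anf p f & (msize p <= r.+1)%N].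

Definition wt (m : nat) (f : boolean_function m) : nat :=
  #|[pred x : 'rV['F_2]_m | f x == 1]|.

Definition weight_spectrum (r m : nat) : set nat :=
  [set wt f | f in @RM r m].

Definition W0 : set nat :=
  [set` [:: 0; 128; 192; 224; 240; 248; 252; 254; 256; 272; 288; 296; 304; 308]%N].

Definition M : set nat :=
  [set` [:: 322; 326; 330; 334; 354; 8174; 8178; 8182; 8186; 8188; 8190; 8194;
            8196; 8198; 8202; 8206; 8210; 16030; 16050; 16054; 16058; 16062]%N].

(* Main.v *)
(* Write a point of F_2^14 as (z, y) with z, y in F_2^7.  If g has degree at most
   7, so has g(z, y) + c(z) for an arbitrary function c of the 7 coordinates z.
   With w_z the weight of g(z, .), the choice of c(z) contributes either w_z or
   128 - w_z to the total weight, independently for each z.  So the weights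
   obtained from one g are all the sums over z of w_z or 128 - w_z, and these
   sums form a very dense set even when g is a sum of at most four indicators of
   7-dimensional subcubes.  The fifteen functions g in [leaders], found by random
   search, together produce every required weight. *)
From Stdlib Require Import BinNat Nnat.
Require Import Defs.

Set Implicit Arguments.
Unset Strict Implicit.
Unset Printing Implicit Defensive.

Import GRing.Theory.

Local Open Scope nat_scope.
Local Open Scope ring_scope.

(** * Algebraic normal forms and closure properties of Reed-Muller codes *)

Lemma F2_cases (a : 'F_2) : a = 0 \/ a = 1.
Proof. by case: a => [[|[|[]]] //] ?; [left|right]; apply/val_inj. Qed.

Lemma F2_expr_minn1 (a : 'F_2) k : a ^+ minn k 1 = a ^+ k.
Proof.
case: k => [|k]; first by rewrite min0n.
by rewrite (minn_idPr _) //; case: (F2_cases a) => ->; rewrite ?expr1n ?expr0n.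
Qed.

(* Since a ^+ k = a for k > 0 in 'F_2, capping all exponents at 1 turns any
   polynomial into an algebraic normal form. *)
Lemma RM_mpoly r m (p : {mpoly 'F_2[m]}) (f : boolean_function m) :
  (forall x : 'rV_m, f x = p.@[fun i => x 0 i]) -> (msize p <= r.+1)%N -> @RM r m f.
Proof.
move=> fE pr; pose red (u : 'X_{1..m}) := [multinom minn (u i) 1 | i < m].
pose q := \sum_(u <- msupp p) p@_u *: 'X_[red u].
(* Distinct monomials may collapse to the same reduced one and cancel, so the support of [q] is only
   included in the image of that of [p]. *)
have supp_q v : v \in msupp q -> exists2 u, u \in msupp p & v = red u.
  move/msupp_sum_le/flattenP => [s /mapP[u]].
  rewrite mem_filter /= => up -> /msuppZ_le.
  by rewrite msuppX inE => /eqP ->; exists u.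
exists q; first split.
- by move=> v /supp_q[u _ ->] i; rewrite mnmE geq_minr.
- move=> x; rewrite fE mevalE raddf_sum /=; apply: eq_bigr => u _.
  rewrite mevalZ mevalX; congr (_ * _); apply: eq_bigr => i _.
  by rewrite mnmE F2_expr_minn1.
rewrite msizeE; apply/bigmax_leqP_seq => v /supp_q[u up ->] _.
apply: leq_trans pr; apply: leq_ltn_trans (msize_mdeg_lt up).
by rewrite !mdegE; apply: leq_sum => i _; rewrite mnmE geq_minl.
Qed.

Section ReedMuller.
Variable m : nat.
Implicit Types f g : boolean_function m.

Lemma eq_RM r f g : f =1 g -> @RM r m f -> @RM r m g.
Proof. by move=> fg [p [pm pE] pr]; exists p => //; split=> // x; rewrite -fg. Qed.

Lemma RM_leq r s f : (r <= s)%N -> @RM r m f -> @RM s m f.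
Proof. by move=> rs [p pE pr]; exists p => //; apply: leq_trans pr _. Qed.

Lemma RM_add r f g : @RM r m f -> @RM r m g -> @RM r m (fun x => f x + g x).
Proof.
move=> [p [_ pE] pr] [q [_ qE] qr]; apply: (RM_mpoly (p := p + q)) => [x|].
  by rewrite mevalD pE qE.
by apply: leq_trans (mmeasureD_le _ _ _) _; rewrite geq_max pr.
Qed.

Lemma RM_mul r s f g :
  @RM r m f -> @RM s m g -> @RM (r + s) m (fun x => f x * g x).
Proof.
move=> [p [_ pE] pr] [q [_ qE] qr]; apply: (RM_mpoly (p := p * q)) => [x|].
  by rewrite mevalM pE qE.
(* [msize] is the degree plus one only for nonzero polynomials, so the degree formula for products
   requires nonzero factors. *)
have [->|p0] := eqVneq p 0; first by rewrite mul0r msize0.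
have [->|q0] := eqVneq q 0; first by rewrite mulr0 msize0.
by rewrite msizeM // -subn1 leq_subLR add1n -addnS -addSn leq_add.
Qed.

Lemma RM_const r a : @RM r m (fun=> a).
Proof.
apply: (RM_mpoly (p := a%:MP)) => [x|]; first by rewrite mevalC.
by rewrite mmeasureC; case: (_ != _).
Qed.

Lemma RM_coord i : @RM 1 m (fun x => x 0 i).
Proof.
by apply: (RM_mpoly (p := 'X_i)) => [x|]; rewrite ?mevalXU // msizeX mdeg1.
Qed.

End ReedMuller.

Arguments RM_const {m} r a.
Arguments RM_coord {m} i.

(** * Sums of subcube indicators and the weights of their translates *)

Local Open Scope nat_scope.

(* A subcube is encoded by one digit per coordinate: 0 or 1 prescribes the
   coordinate, 2 leaves it free; a missing digit counts as free. *)
Definition fits (c : nat) (b : bool) := (c == 2) || (c == b).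

Fixpoint hits (p : seq nat) (s : seq bool) : bool :=
  if s is b :: s' then fits (head 2 p) b && hits (behead p) s' else true.

Definition flat_sum (P : seq (seq nat)) (s : seq bool) := odd (count (hits^~ s) P).

Definition restr (b : bool) (P : seq (seq nat)) :=
  [seq behead p | p <- P & fits (head 2 p) b].

Fixpoint cube n : seq (seq bool) :=
  if n is n'.+1 then map (cons false) (cube n') ++ map (cons true) (cube n')
  else [:: [::]].

(** The empty list is tested first, so that a branch is abandoned as soon as no subcube meets it. At
    depth 0 every remaining subcube contains the point, hence the parity. *)
Fixpoint weight n P : nat :=
  if P is [::] then 0 else
  if n is n'.+1 then weight n' (restr false P) + weight n' (restr true P)
  else odd (size P).

(* Sets of naturals are represented by the bits of an [N].  The result is [acc]
   shifted by all weights of the functions flat_sum P (z ++ y) + c z with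
   z of length k and y of length n. *)
Fixpoint reach k n P acc : N :=
  if k is k'.+1 then reach k' n (restr true P) (reach k' n (restr false P) acc)
  else let w := weight n P in
       N.lor (N.shiftl acc (N.of_nat w)) (N.shiftl acc (N.of_nat (2 ^ n - w))).

Lemma flat_sum_cons P b s : flat_sum P (b :: s) = flat_sum (restr b P) s.
Proof.
rewrite /flat_sum /restr count_map count_filter; congr odd.
by apply: eq_count => p /=; rewrite andbC.
Qed.

Lemma weightE n P : weight n P = count (flat_sum P) (cube n).
Proof.
elim: n P => [|n IH] [|p P] //=; try by rewrite count_pred0.
  by rewrite addn0 /flat_sum /= count_predT.
rewrite count_cat !count_map !IH.
by congr (_ + _); apply: eq_count => s /=; rewrite flat_sum_cons.
Qed.

Lemma size_cube n : size (cube n) = 2 ^ n.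
Proof. by elim: n => //= n IH; rewrite size_cat !size_map IH expnS mul2n addnn. Qed.

Lemma cons_inj (T : Type) (x : T) : injective (cons x).
Proof. by move=> s t []. Qed.

Lemma mem_cube n s : (s \in cube n) = (size s == n).
Proof.
have nmem a b t (C : seq (seq bool)) : a != b -> (a :: t \in map (cons b) C) = false.
  by move=> ab; apply/mapP => [[u _ [abE _]]]; rewrite abE eqxx in ab.
elim: n s => [|n IH] [|b s] //=; rewrite mem_cat.
  by apply/norP; split; apply/mapP => [[]].
rewrite eqSS -IH; case: b.
  by rewrite (nmem true false) // (mem_map (@cons_inj _ _)).
by rewrite (nmem false true) // orbF (mem_map (@cons_inj _ _)).
Qed.

Lemma cube_uniq n : uniq (cube n).
Proof.
elim: n => //= n IH; rewrite cat_uniq !(map_inj_uniq (@cons_inj _ _)) IH andbT /=.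
by apply/hasPn => s /mapP[t _ ->]; apply/mapP => [[]].
Qed.

Lemma testbit_shiftl a k n : N.testbit (N.shiftl a (N.of_nat k)) (N.of_nat n) ->
  exists2 j, N.testbit a (N.of_nat j) & n = j + k.
Proof.
case: (leqP k n) => [/leP kn|/ltP nk]; last first.
  rewrite N.shiftl_spec_low // /N.lt -Nnat.Nat2N.inj_compare.
  exact/PeanoNat.Nat.compare_lt_iff.
rewrite N.shiftl_spec_high' -?Nnat.Nat2N.inj_sub => [?|].
  by exists (n - k) => //; rewrite subnK //; apply/leP.
by rewrite /N.le -Nnat.Nat2N.inj_compare; apply/PeanoNat.Nat.compare_le_iff.
Qed.

Lemma testbit_lor_foldr (T : eqType) (F : T -> N) s n :
  N.testbit (foldr (fun t => N.lor (F t)) 0%num s) n ->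
  exists2 t, t \in s & N.testbit (F t) n.
Proof.
elim: s => [|t s IH] /=; first by [].
rewrite N.lor_spec => /orP[? |/IH[u us ?]]; first by exists t; rewrite ?mem_head.
by exists u; rewrite // in_cons us orbT.
Qed.

(** Each level fixes one coordinate of z, and [c] is glued from the functions found on the two
    halves. At depth 0 it is a constant: false keeps the weight, true complements it. *)
Lemma reachP k n P acc w : N.testbit (reach k n P acc) (N.of_nat w) ->
  exists c : seq bool -> bool, exists2 w0, N.testbit acc (N.of_nat w0) &
    w = w0 + count (fun s => flat_sum P s (+) c (take k s)) (cube (k + n)).
Proof.
elim: k P acc w => [|k IH] P acc w /=; last first.
  move=> /IH[c1 [w1 /IH[c0 [w0 w0acc ->]] ->]].
  exists (fun s => if s is b :: s' then (if b then c1 s' else c0 s') else false).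
  exists w0 => //; rewrite count_cat !count_map addnA.
  by congr (_ + _ + _); apply: eq_count => s /=; rewrite flat_sum_cons.
rewrite N.lor_spec weightE => /orP[] /testbit_shiftl[w0 ? ->].
  exists (fun=> false), w0 => //; congr (_ + _).
  by apply: eq_count => s; rewrite addbF.
exists (fun=> true), w0 => //; congr (_ + _).
(* Here [2 ^ n] counts all points, so the difference counts the zeros of [flat_sum P]. *)
rewrite -size_cube -(count_predC (flat_sum P)) addKn.
by apply: eq_count => s; rewrite /= addbT.
Qed.

(** * From Boolean sequences to codewords *)

Section Codewords.
Variable m : nat.

(** With the list of coordinates as a parameter, inductions can consume one coordinate at a time,
    and a prefix of a point is [bits] of a prefix of the list. *)
Definition bits (l : seq 'I_m) (x : 'rV['F_2]_m) := [seq x ord0 i == 1%R | i <- l].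

(** Every function of a single bit is affine in it. *)
Lemma RM_bit (h : bool -> bool) i : @RM 1 m (fun x => (h (x ord0 i == 1%R))%:R)%R.
Proof.
pose a : 'F_2 := ((h true)%:R - (h false)%:R)%R.
apply: (@eq_RM m 1 (fun x => (h false)%:R + a * x ord0 i)%R) => [x|].
  by rewrite /a; case: (F2_cases (x ord0 i)) => ->; rewrite /= ?mulr0 ?addr0 // mulr1 addrC subrK.
apply: RM_add; first exact: RM_const.
exact: (RM_mul (RM_const 0 _) (RM_coord _)).
Qed.

(** The indicator is a product with a factor of degree at most 1 for each prescribed coordinate and
    a constant factor for each free one. *)
Lemma RM_hits (l : seq 'I_m) p :
  @RM (count (predC1 2) p) m (fun x => (hits p (bits l x))%:R)%R.
Proof.
elim: l p => [|i l IH] p /=; first exact: RM_const.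
apply: (@eq_RM m _ (fun x => (fits (head 2 p) (x ord0 i == 1%R))%:R * (hits (behead p) (bits l x))%:R)%R).
  by move=> x; rewrite -natrM mulnb.
case: p => [|c p]; first exact: (RM_mul (RM_const 0 _) (IH [::])).
apply: (RM_mul (f := fun x => (fits c (x ord0 i == 1%R))%:R%R) _ (IH p)).
rewrite /= /fits.
by case: (c == 2); [exact: RM_const|exact: (RM_bit (fun b => c == b))].
Qed.

Lemma F2_addb (a b : bool) : ((a (+) b)%:R = a%:R + b%:R :> 'F_2)%R.
Proof. by case: a; case: b; rewrite ?addr0 ?add0r //; apply/val_inj. Qed.

Lemma RM_flat_sum r (l : seq 'I_m) P :
  all (fun p => count (predC1 2) p <= r) P ->
  @RM r m (fun x => (flat_sum P (bits l x))%:R)%R.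
Proof.
elim: P => [_|p P IH /= /andP[pr Pr]]; first exact: RM_const.
apply: (@eq_RM m r (fun x => (hits p (bits l x))%:R + (flat_sum P (bits l x))%:R)%R).
  by move=> x; rewrite /flat_sum /= oddD oddb F2_addb.
by apply: RM_add (IH Pr); exact: (RM_leq pr (RM_hits _ _)).
Qed.

(** Shannon expansion along the first coordinate: each coordinate raises the degree by at most one,
    whatever [c] is. *)
Lemma RM_prefix (l : seq 'I_m) (c : seq bool -> bool) :
  @RM (size l) m (fun x => (c (bits l x))%:R)%R.
Proof.
elim: l c => [|i l IH] c /=; first exact: RM_const.
pose b (x : 'rV['F_2]_m) := x ord0 i == 1%R.
apply: (@eq_RM m _ (fun x => (b x)%:R * (c (true :: bits l x))%:R
                      + (~~ b x)%:R * (c (false :: bits l x))%:R)%R).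
  by move=> x; rewrite /= -/(b x); case: (b x); rewrite ?mul0r ?mul1r ?addr0 ?add0r.
apply: RM_add; rewrite -add1n.
  exact: (RM_mul (RM_bit id i) (IH (fun s => c (true :: s)))).
exact: (RM_mul (RM_bit negb i) (IH (fun s => c (false :: s)))).
Qed.

(** Reading off all coordinates is a bijection from the points onto [cube m]. *)
Lemma wt_bits (h : seq bool -> bool) :
  wt (fun x : 'rV['F_2]_m => (h (bits (enum 'I_m) x))%:R%R) = count h (cube m).
Proof.
have bitsK : injective (bits (enum 'I_m)).
  move=> x y /eq_in_map xy; apply/rowP => i.
  have := xy i (mem_enum _ i).
  by case: (F2_cases (x ord0 i)) => ->; case: (F2_cases (y ord0 i)) => ->.
rewrite /wt cardE size_filter.
transitivity (count h [seq bits (enum 'I_m) x | x <- enum {: 'rV['F_2]_m}]).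
  move: (bits _) => b; rewrite count_map enumT; apply: eq_count => x.
  by transitivity ((h (b x))%:R == 1%R :> 'F_2) => //=; case: (h _).
apply: (seq.permP _ h); apply: uniq_perm => [||s].
- by rewrite (map_inj_uniq bitsK) enum_uniq.
- exact: cube_uniq.
rewrite mem_cube; apply/mapP/eqP => [[x _ ->]|sz].
  by rewrite size_map size_enum_ord.
exists (\row_i (nth false s i)%:R)%R; rewrite ?mem_enum //.
apply: (@eq_from_nth _ false) => [|i]; first by rewrite size_map size_enum_ord.
rewrite sz => im.
rewrite (nth_map (Ordinal im)) ?size_enum_ord // mxE nth_enum_ord //.
by case: (nth _ _ _).
Qed.

Lemma weight_spectrum_reach k n r P w : m = k + n -> k <= r ->
  all (fun p => count (predC1 2) p <= r) P ->
  N.testbit (reach k n P 1) (N.of_nat w) -> weight_spectrum r m w.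
Proof.
move=> mE kr Pr /reachP[c [w0 w01 ->]].
(* The accumulator 1 has only bit 0 set, so it encodes the set {0}. *)
have -> : w0 = 0 by case: w0 w01.
pose h s := flat_sum P s (+) c (take k s).
exists (fun x => (h (bits (enum 'I_m) x))%:R)%R; last by rewrite wt_bits mE.
apply: (@eq_RM m r (fun x => (flat_sum P (bits (enum 'I_m) x))%:R
                      + (c (bits (take k (enum 'I_m)) x))%:R)%R).
  by move=> x; rewrite -F2_addb /h /bits map_take.
apply: RM_add; first exact: RM_flat_sum.
apply: RM_leq (RM_prefix _ _).
by apply: leq_trans kr; rewrite size_take_min geq_minl.
Qed.

End Codewords.

(** * Testing many weights in one binary number *)

(** Dropping two bits per step walks through the number once, instead of looking up thousands of
    positions separately. *)
Fixpoint even_bits k a :=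
  if k is k'.+1 then N.odd a && even_bits k' (N.div2 (N.div2 a)) else true.

Lemma even_bitsP k a i : even_bits k a -> i < k -> N.testbit a (N.of_nat (2 * i)).
Proof.
elim: k a i => // k IH a i /andP[a0 ak]; case: i => [_|i ik].
  exact: etrans (N.bit0_odd a) a0.
by rewrite mulnS add2n !Nnat.Nat2N.inj_succ -!N.testbit_div2; apply: IH.
Qed.

Definition bitset s := foldr (fun w => N.lor (N.shiftl 1 (N.of_nat w))) 0%num s.

(** Setting the bits of the exceptions [s] by hand allows one uniform test of all even positions; a
    bit that passes comes from [a] or from [s]. *)
Lemma even_bits_bitset k a s b i :
  even_bits k (N.shiftr (N.lor a (bitset s)) (N.of_nat b)) -> i < k ->
  N.testbit a (N.of_nat (b + 2 * i)) \/ b + 2 * i \in s.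
Proof.
move=> abs /(even_bitsP abs).
rewrite N.shiftr_spec' -Nnat.Nat2N.inj_add plusE addnC N.lor_spec.
case/orP => [|/testbit_lor_foldr[v vs /testbit_shiftl[j j1 ->]]]; [by left|right].
by have -> : j = 0 by case: j j1.
Qed.

Definition reach_all k n Ps := foldr (fun P => N.lor (reach k n P 1)) 0%num Ps.

Lemma weight_spectrum_reach_all k n r Ps w : k <= r ->
  all (all (fun p => count (predC1 2) p <= r)) Ps ->
  N.testbit (reach_all k n Ps) (N.of_nat w) -> weight_spectrum r (k + n) w.
Proof.
move=> kr Psr /testbit_lor_foldr[P PsP]; apply: weight_spectrum_reach => //.
exact: (allP Psr).
Qed.

(** * The explicit functions and the final computation *)

Definition leaders : seq (seq (seq nat)) :=
 [::
  [:: [:: 1; 1; 1; 2; 2; 2; 2; 2; 2; 2; 1; 1; 1; 1];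
      [:: 2; 2; 2; 1; 1; 1; 1; 1; 1; 1; 2; 2; 2; 2];
      [:: 2; 1; 1; 2; 2; 2; 2; 2; 2; 0; 1; 1; 1; 1];
      [:: 2; 2; 2; 1; 1; 2; 1; 1; 1; 1; 2; 2; 2; 0]];
  [:: [:: 1; 2; 1; 1; 2; 1; 0; 2; 2; 2; 1; 2; 2; 0];
      [:: 1; 0; 2; 2; 2; 1; 2; 0; 2; 2; 2; 0; 1; 0];
      [:: 1; 2; 1; 1; 2; 1; 2; 2; 1; 1; 1; 2; 2; 2]];
  [:: [:: 1; 1; 1; 1; 1; 1; 0; 2; 2; 2; 2; 2; 2; 2]];
  [:: [:: 2; 0; 0; 2; 2; 0; 2; 2; 2; 1; 2; 0; 1; 0];
      [:: 2; 2; 2; 1; 2; 2; 1; 1; 1; 1; 0; 2; 2; 0]];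
  [:: [:: 1; 1; 2; 1; 2; 1; 1; 1; 2; 2; 2; 2; 1; 2];
      [:: 2; 2; 1; 2; 1; 2; 2; 2; 1; 1; 1; 1; 2; 1];
      [:: 1; 1; 1; 2; 1; 1; 1; 2; 2; 2; 2; 1; 2; 2]];
  [:: [:: 1; 0; 0; 0; 2; 0; 2; 2; 0; 2; 2; 2; 1; 2];
      [:: 1; 2; 2; 2; 0; 2; 1; 1; 2; 0; 2; 1; 2; 0]];
  [:: [:: 1; 2; 2; 1; 2; 1; 1; 1; 2; 1; 1; 2; 2; 2];
      [:: 2; 1; 1; 2; 1; 2; 2; 2; 1; 2; 2; 1; 1; 1];
      [:: 1; 1; 2; 2; 1; 1; 1; 1; 2; 2; 1; 2; 2; 2]];
  [:: [:: 1; 1; 1; 1; 1; 1; 1; 2; 2; 2; 2; 2; 2; 2];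
      [:: 2; 2; 2; 2; 2; 2; 2; 1; 1; 1; 1; 1; 1; 1];
      [:: 2; 2; 2; 1; 1; 2; 2; 1; 1; 2; 1; 1; 2; 1];
      [:: 1; 1; 2; 2; 2; 2; 1; 1; 1; 2; 1; 2; 2; 1]];
  [:: [:: 2; 1; 2; 1; 0; 2; 1; 2; 2; 1; 1; 2; 2; 1];
      [:: 1; 1; 2; 1; 2; 1; 2; 1; 2; 2; 2; 1; 1; 2];
      [:: 2; 1; 1; 1; 2; 1; 2; 2; 1; 2; 2; 2; 1; 1]];
  [:: [:: 0; 2; 2; 1; 2; 0; 1; 0; 0; 2; 0; 2; 2; 2];
      [:: 0; 2; 2; 1; 2; 2; 1; 2; 2; 1; 2; 0; 1; 1]];
  [:: [:: 1; 1; 2; 1; 2; 2; 2; 1; 2; 2; 1; 2; 1; 1];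
      [:: 2; 2; 1; 2; 1; 1; 1; 2; 1; 1; 2; 1; 2; 2];
      [:: 2; 2; 1; 2; 2; 2; 1; 2; 1; 1; 2; 1; 0; 1]];
  [:: [:: 2; 2; 2; 1; 2; 2; 2; 2; 0; 1; 0; 1; 0; 1];
      [:: 1; 2; 1; 2; 2; 2; 1; 2; 0; 2; 0; 1; 2; 1]];
  [:: [:: 0; 0; 1; 0; 2; 1; 1; 2; 2; 2; 2; 2; 1; 2];
      [:: 2; 2; 1; 0; 2; 1; 1; 2; 2; 2; 1; 2; 0; 1];
      [:: 2; 2; 1; 2; 0; 2; 1; 1; 1; 2; 1; 2; 2; 1]];
  [:: [:: 1; 2; 1; 1; 2; 2; 2; 1; 2; 2; 1; 2; 1; 1];
      [:: 2; 1; 2; 2; 1; 1; 1; 2; 1; 1; 2; 1; 2; 2];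
      [:: 1; 2; 2; 1; 1; 1; 1; 1; 2; 2; 2; 2; 1; 2]];
  [:: [:: 0; 2; 1; 1; 2; 0; 2; 2; 0; 2; 1; 1; 2; 2];
      [:: 0; 2; 2; 1; 1; 2; 2; 2; 0; 0; 1; 1; 2; 2]]].

Definition reachable := reach_all 7 7 leaders.

Definition w0s :=
  [:: 0; 128; 192; 224; 240; 248; 252; 254; 256; 272; 288; 296; 304; 308].

Definition excluded :=
  [:: 322; 326; 330; 334; 354; 8174; 8178; 8182; 8186; 8188; 8190; 8194; 8196;
      8198; 8202; 8206; 8210; 16030; 16050; 16054; 16058; 16062].

Lemma leaders_degree : all (all (fun p => count (predC1 2) p <= 7)) leaders.
Proof. by []. Qed.

(** The number of admissible i is 7881 = 2^13 - 312 + 1, and the shift by 312 moves the weight 312 +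
    2i to position 2i. *)
Lemma reachable_even :
  even_bits 7881 (N.shiftr (N.lor reachable (bitset excluded)) (N.of_nat 312)).
Proof. by vm_compute. Qed.

Lemma reachable_w0s : all (fun w => N.testbit reachable (N.of_nat w)
  && N.testbit reachable (N.of_nat (2 ^ 14 - w))) w0s.
Proof. by vm_compute. Qed.

Lemma reachable_spectrum w :
  N.testbit reachable (N.of_nat w) -> weight_spectrum 7 14 w.
Proof. exact: (@weight_spectrum_reach_all 7 7 7 leaders w isT leaders_degree). Qed.

Local Open Scope classical_set_scope.

Theorem proposition4 :
  (W0 `|` [set 312 + 2 * i | i in [set i : nat | i <= 2 ^ 13 - 312]]
      `|` [set 2 ^ 14 - w | w in W0]) `\` M
  `<=` weight_spectrum 7 14.
Proof.
move=> w [ww wM]; apply: reachable_spectrum.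
case: ww => [[w0|[i ile wE]]|[v v0 <-]].
- by case/andP: (allP reachable_w0s w w0).
- have i_lt : i < 7881 by apply: leq_ltn_trans ile _; vm_compute.
  (* Either w is reachable, or it lies in [excluded], which lists [M] and so contradicts [wM]. *)
  by case: (even_bits_bitset reachable_even i_lt); rewrite wE.
- by case/andP: (allP reachable_w0s v v0).
Qed.
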